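(* Let $k\geq 4$ be an integer. Suppose that for every graph $H$ with $\Delta(H)=k-1$ all proper $(\chi'(H)+1)$-edge colorings of $H$ are Kempe equivalent. Then for every Class 2 graph $G$ with $\Delta(G)=k$, all proper $(k+2)$-edge colorings of $G$ are Kempe equivalent.
   Context: All graphs are finite, without loops and multiple edges. $\Delta(G)$ is the maximum degree of $G$. A proper $t$-edge coloring of $G$ is a map $f:E(G)\to\{1,\dots,t\}$ with $f(e)\neq f(e')$ for adjacent edges $e,e'$. The chromatic index $\chi'(G)$ is the least $k$ for which a proper $k$-edge coloring exists; $G$ is Class 2 if $\chi'(G)=\Delta(G)+1$. For a proper edge coloring $f$ and colors $a,b$, $G_f(a,b)$ is the subgraph induced by the edges colored $a$ or $b$. An interchange (Kempe change) consists of swapping colors $a$ and $b$ on one connected component of $G_f(a,b)$. Two proper edge colorings are Kempe equivalent if one can be obtained from the other by a sequence of interchanges. *)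

(* Defs.v *)
From Stdlib Require Import Relation_Definitions Relation_Operators.
From mathcomp Require Import all_boot.
Set Implicit Arguments. Unset Strict Implicit. Unset Printing Implicit Defensive.

Section Graphs.
Variables (V : finType) (g : rel V).

Definition simple_graph : Prop := symmetric g /\ irreflexive g.

Definition deg (v : V) : nat := #|[set u | g v u]|.
Definition Delta : nat := \max_(v : V) deg v.

Definition edgeset : {set {set V}} :=
  [set A : {set V} | [exists x, exists y, g x y && (A == [set x; y])]].

End Graphs.

Notation edge g := {A : {set _} | A \in edgeset g}.

Notation coloring g t := {ffun edge g -> 'I_t}.

Section Colorings.
Variables (V : finType) (g : rel V) (t : nat).

Definition adjacent (e e' : edge g) : bool :=
  (e != e') && (val e :&: val e' != set0).

Definition properb (f : coloring g t) : bool :=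
  [forall e, forall e', adjacent e e' ==> (f e != f e')].

Definition has_coloring : bool := [exists f : coloring g t, properb f].

(* Kempe change: swap colors a and b on the connected component of G_f(a,b)
   containing the edge e0 (if f e0 is neither a nor b nothing changes). *)
Definition ab_adj (f : coloring g t) (a b : 'I_t) : rel (edge g) :=
  fun e e' => [&& f e \in [:: a; b], f e' \in [:: a; b] & adjacent e e'].

Definition swapc (a b c : 'I_t) : 'I_t :=
  if c == a then b else if c == b then a else c.

Definition interchange (f : coloring g t) (a b : 'I_t) (e0 : edge g)
  : coloring g t :=
  [ffun e => if connect (ab_adj f a b) e0 e then swapc a b (f e) else f e].

Definition kempe_step (f f' : coloring g t) : Prop :=
  exists a b e0, f' = interchange f a b e0.

Definition kempe_equiv : relation (coloring g t) :=
  clos_refl_trans _ kempe_step.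

End Colorings.

(* chromatic index: least t with a proper t-edge coloring
   (#|{: edge g}| colors always suffice, so the search range is exhaustive) *)
Definition chromatic_index (V : finType) (g : rel V) : nat :=
  find (fun t => has_coloring g t) (iota 0 (#|{: edge g}|.+1)).

Definition class2 (V : finType) (g : rel V) : Prop :=
  chromatic_index g = (Delta g).+1.

(* Main.v *)
Require Import Defs.
From Stdlib Require Import Relation_Definitions Relation_Operators.
From mathcomp Require Import all_boot.
Set Implicit Arguments. Unset Strict Implicit. Unset Printing Implicit Defensive.

(** Key reduction: if every degree is less than [t] and the vertices of degree
    [t - 1] are independent, then every proper [t]-edge coloring can be rid of
    any given color [z] by Kempe changes.  This is Vizing's fan argument; a fan
    at [u] fails only when it reaches a vertex [w] of degree [t - 1] missing
    nothing but [z], and then, after swapping [z] with a color missing at [u]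
    along the chain of [w], a fan at [w] succeeds because all its leaves have
    smaller degree.

    Hence, in [G], both colorings may be assumed to avoid the last color, and
    the edges of any matching [M] can be recolored with it one at a time, so it
    is enough to find [M] such that all proper [k+1]-edge colorings of [H = G - M]
    are equivalent.  Let [M] be a maximal matching; the vertices of degree [k] in
    [H] are then independent, so [H] is [k]-edge colorable, but not
    [(k-1)]-edge colorable as [G] is Class 2.  If [Delta H = k - 1] the hypothesis
    applies to [H].  Otherwise [Delta H = k], and the same reduction applies to
    [H] and a color class [N] of a [k]-edge coloring of [H]: the graph [H - N] has
    maximum degree and chromatic index [k - 1], so the hypothesis applies to it. *)

(** * Paths in symmetric relations of degree at most two *)

Lemma connect_ind_r (T : finType) (r : rel T) (x : T) (P : T -> Prop) :
  P x -> (forall y z, P y -> r y z -> P z) -> forall y, connect r x y -> P y.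
Proof.
move=> Px IH y /connectP[p + ->]; elim/last_ind: p => [//|p z IHp].
by rewrite rcons_path last_rcons => /andP[/IHp Pl rz]; apply: IH rz.
Qed.

(** A component of maximum degree two is a path or a cycle, so it cannot contain three vertices of
    degree at most one. *)
Lemma three_ends (T : finType) (r : rel T) (x y z : T) :
  symmetric r ->
  (forall u a b c, r u a -> r u b -> r u c -> [\/ a = b, a = c | b = c]) ->
  (forall u, u \in [:: x; y; z] -> forall a b, r u a -> r u b -> a = b) ->
  uniq [:: x; y; z] -> connect r x y -> connect r x z -> False.
Proof.
move=> rC r2 r1 xyz /connectP[p0 p0P yE].
have [nxy [nxz nyz]] : x <> y /\ x <> z /\ y <> z.
  move: xyz; rewrite /= !inE negb_or => /andP[/andP[/eqP ? /eqP ?]].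
  by move=> /andP[/eqP ? _].
case/shortenP: p0P yE => p pP up _ yE cxz.
have step i : i < size p -> r (nth x (x :: p) i) (nth x (x :: p) i.+1).
  by move=> ip; move/pathP: pP => /(_ x i ip).
have yn : y = nth x (x :: p) (size p) by rewrite yE (last_nth x).
have inj i j : i <= size p -> j <= size p ->
    nth x (x :: p) i = nth x (x :: p) j -> i = j.
  by move=> ip jp /eqP; rewrite nth_uniq // => /eqP.
have inter i : 0 < i -> i < size p ->
    let q := nth x (x :: p) i in
    exists a b, [/\ r q a, r q b, a <> b, a \in x :: p & b \in x :: p].
  case: i => // i _ ip q.
  exists (nth x (x :: p) i), (nth x (x :: p) i.+2).
  split.
  - by rewrite rC; apply: step; apply: ltnW.
  - exact: step.
  - by move/inj => /(_ (ltnW (ltnW ip)) ip) /eqP; rewrite ltn_eqF.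
  - by apply: mem_nth; rewrite /= ltnS ltnW // ltnW.
  - exact: mem_nth.
have p_gt0 : 0 < size p.
  by case: (posnP (size p)) => // p_nil; case: nxy; rewrite yn p_nil.
(* The simple path from [x] to [y] is closed under [r]: inner vertices already have both neighbors
   on it, and each end has its only one. Hence [z] lies on it, as an inner vertex with two distinct
   neighbors. *)
have zp : z \in x :: p.
  pattern z; apply: connect_ind_r cxz; first exact: mem_head.
  move=> q s /(nthP x)[i]; rewrite /= ltnS leq_eqVlt => /orP[/eqP ->|ip] <- rqs.
    have := step (size p).-1; rewrite prednK // leqnn => /(_ isT); rewrite rC.
    rewrite -yn in rqs * => ryl.
    have -> : s = nth x (x :: p) (size p).-1 by apply: (r1 y) => //; rewrite !inE eqxx orbT.
    by apply: mem_nth; rewrite /= ltnS leq_pred.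
  case: (posnP i) rqs => [-> rqs|i0 rqs].
    have -> : s = nth x (x :: p) 1.
      by apply: (r1 x) => //; [rewrite inE eqxx | apply: (step 0)].
    exact: mem_nth.
  have [a [b [ra rb nab pa pb]]] := inter i i0 ip.
  by case: (r2 _ _ _ _ ra rb rqs) => [//|<-|<-].
case/(nthP x): zp => i; rewrite /= ltnS leq_eqVlt => /orP[/eqP ->|ip] zE.
  by case: nyz; rewrite yn -zE.
case: (posnP i) => [i0|i0]; first by case: nxz; rewrite -zE i0.
have [a [b [ra rb nab _ _]]] := inter i i0 ip.
by case: nab; apply: (r1 z); rewrite ?inE ?eqxx ?orbT // -zE.
Qed.

(** * Swaps of two colors and symmetry of Kempe equivalence *)

Section Swap.
Variables (t : nat).
Implicit Types a b c : 'I_t.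

Lemma swapcK a b : involutive (swapc a b).
Proof.
move=> c; rewrite /swapc; case: (eqVneq c a) => [->|/negPf ca].
  by rewrite eqxx; case: eqVneq.
by case: (eqVneq c b) => [->|/negPf cb]; rewrite ?eqxx // ca cb.
Qed.

Lemma swapcL a b : swapc a b a = b. Proof. by rewrite /swapc eqxx. Qed.
Lemma swapcR a b : swapc a b b = a.
Proof. by rewrite /swapc eqxx; case: eqP. Qed.
Lemma swapcN a b c : c != a -> c != b -> swapc a b c = c.
Proof. by rewrite /swapc => /negPf-> /negPf->. Qed.
Lemma swapc_mem a b c : (swapc a b c \in [:: a; b]) = (c \in [:: a; b]).
Proof.
rewrite /swapc !inE; case: (eqVneq c a) => [_|/negPf ca]; first by rewrite eqxx orbT.
by case: (eqVneq c b) => [_|/negPf cb]; rewrite ?eqxx // ca cb.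
Qed.
End Swap.

Section KempeSym.
Variables (V : finType) (g : rel V) (t : nat).
Implicit Type f : coloring g t.

(** An interchange is its own inverse: it keeps the set of edges colored [a] or [b], so the same
    component is swapped back. *)
Lemma kempe_step_sym f f' : kempe_step f f' -> kempe_step f' f.
Proof.
case=> a [b [e0 ->]]; exists a, b, e0.
have mem e : (Defs.interchange f a b e0 e \in [:: a; b]) = (f e \in [:: a; b]).
  by rewrite ffunE; case: ifP => // _; rewrite swapc_mem.
apply/ffunP => e; rewrite [RHS]ffunE.
rewrite (@eq_connect _ _ (ab_adj f a b)); last first.
  by move=> e1 e2; rewrite /ab_adj !mem.
by rewrite ffunE; case: (connect _ _ _); rewrite ?swapcK.
Qed.

Lemma kempe_equiv_sym f f' : kempe_equiv f f' -> kempe_equiv f' f.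
Proof.
elim=> [f1 f2 /kempe_step_sym|f1|f1 f2 f3 _ ? _ ?]; first exact: rt_step.
  exact: rt_refl.
by apply: rt_trans; eassumption.
Qed.
End KempeSym.

(** * Colorings and Kempe chains seen from the vertices *)

Section VertexView.
Variables (V : finType) (g : rel V) (t : nat).
Hypothesis gS : simple_graph g.
Implicit Type f : coloring g t.

(** Indexing colors by pairs of vertices, with [None] on non-edges, avoids membership proofs for
    edges; equality with [Some c] already entails adjacency. *)
Definition ec f (x y : V) : option 'I_t := omap f (insub [set x; y]).
Definition misses f (x : V) (c : 'I_t) : bool := [forall y, ec f x y != Some c].

Lemma ecC f x y : ec f x y = ec f y x.
Proof. by rewrite /ec setUC. Qed.

Lemma set2_eq (x y a b : V) :
  [set x; y] = [set a; b] -> (x = a /\ y = b) \/ (x = b /\ y = a).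
Proof.
move=> E.
have: x \in [set a; b] by rewrite -E !inE eqxx.
have: y \in [set a; b] by rewrite -E !inE eqxx orbT.
have: a \in [set x; y] by rewrite E !inE eqxx.
have: b \in [set x; y] by rewrite E !inE eqxx orbT.
rewrite !inE => /orP[]/eqP? /orP[]/eqP? /orP[]/eqP? /orP[]/eqP?; subst; auto.
Qed.

Lemma mem_edgeset x y : ([set x; y] \in edgeset g) = g x y.
Proof.
case: gS => gC _; apply/idP/idP => [|gxy].
  rewrite inE => /existsP[a /existsP[b /andP[gab /eqP /set2_eq[][-> ->//]]]].
  by rewrite gC.
by rewrite inE; apply/existsP; exists x; apply/existsP; exists y; rewrite gxy eqxx.
Qed.

Lemma edge_ends (e : edge g) : exists x y, g x y /\ val e = [set x; y].
Proof.
case: e => A /= AP; have := AP; rewrite inE => /existsP[x /existsP[y /andP[? /eqP]]].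
by exists x, y.
Qed.

Lemma ec_val f (e : edge g) x y : val e = [set x; y] -> ec f x y = Some (f e).
Proof. by rewrite /ec => <-; rewrite valK. Qed.

Lemma ec_someP f x y c :
  ec f x y = Some c -> exists2 e : edge g, val e = [set x; y] & f e = c.
Proof. by rewrite /ec; case: insubP => //= e _ eE [<-]; exists e. Qed.

Lemma ec_isSome f x y : (ec f x y : bool) = g x y.
Proof. by rewrite -mem_edgeset /ec; case: insubP => [e ->|/negPf->]. Qed.

Lemma ec_adj f x y c : ec f x y = Some c -> g x y.
Proof. by rewrite -(ec_isSome f) => ->. Qed.

Lemma eq_ec f f' : (forall x y, ec f x y = ec f' x y) -> f = f'.
Proof.
move=> E; apply/ffunP => e; have [x [y [_ exy]]] := edge_ends e.
by have := E x y; rewrite !(ec_val _ exy) => -[].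
Qed.

Lemma proper_ecP f :
  reflect (forall x y y' c, ec f x y = Some c -> ec f x y' = Some c -> y = y')
          (properb f).
Proof.
have gI : irreflexive g by case: gS.
apply: (iffP forallP) => [fP x y y' c|fP e].
  move=> exy exy'; have gxy := ec_adj exy; have gxy' := ec_adj exy'.
  case/ec_someP: exy => e eE fe; case/ec_someP: exy' => e' eE' fe'.
  apply/eqP/negPn/negP => nyy'.
  move/forallP: (fP e) => /(_ e')/implyP; rewrite fe fe' eqxx; case/(_ _)/negP=> //.
  apply/andP; split; last first.
    by apply/set0Pn; exists x; rewrite eE eE' !inE eqxx.
  apply/eqP => ee'; move: eE; rewrite ee' eE' => /set2_eq[][].
    by move=> _ yy'; rewrite yy' eqxx in nyy'.
  by move=> E; rewrite E gI in gxy.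
apply/forallP => e'; apply/implyP => /andP[nee' /set0Pn[x]].
rewrite inE => /andP[xe xe']; apply/eqP => ff.
have split2 (d : edge g) : x \in val d -> exists y, val d = [set x; y].
  have [a [b [_ ->]]] := edge_ends d; rewrite !inE => /orP[]/eqP->; first by exists b.
  by exists a; rewrite setUC.
have [y ye] := split2 _ xe; have [y' ye'] := split2 _ xe'.
have := fP x y y' (f e); rewrite (ec_val f ye) (ec_val f ye') ff.
move=> /(_ erefl erefl) yy'; case/eqP: nee'; apply: val_inj.
by rewrite ye ye' yy'.
Qed.

Lemma missesP f x c : reflect (forall y, ec f x y <> Some c) (misses f x c).
Proof. by apply: (iffP forallP) => H y; apply/eqP; apply: H. Qed.

Lemma missesPn f x c : reflect (exists y, ec f x y = Some c) (~~ misses f x c).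
Proof.
apply: (iffP idP) => [/forallPn[y /negPn/eqP]|[y yE]]; first by exists y.
by apply/negP => /missesP/(_ y).
Qed.

Definition chain f a b : rel V := fun x y => ec f x y \in [:: Some a; Some b].

Lemma chainC f a b : symmetric (chain f a b).
Proof. by move=> x y; rewrite /chain ecC. Qed.

(** Interchanges follow components of edges, while fans need components of vertices. Testing only
    the end [y] of an edge is enough: an edge colored [a] or [b] has both ends in one component, and
    [swapc] fixes all other colors. *)
Lemma swap_chain f a b x0 : properb f -> exists f' : coloring g t,
  [/\ kempe_equiv f f', properb f',
   forall y w, ec f' y w = if connect (chain f a b) x0 y
               then omap (swapc a b) (ec f y w) else ec f y w
   & forall y c, misses f' y c =
      misses f y (if connect (chain f a b) x0 y then swapc a b c else c)].
Proof.
move=> fP; set r := chain f a b.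
suff [f' kf ef'] : exists2 f' : coloring g t, kempe_equiv f f' &
   forall y w, ec f' y w = if connect r x0 y
               then omap (swapc a b) (ec f y w) else ec f y w.
  exists f'; split=> //.
    apply/proper_ecP => x y y' c; rewrite !ef'; case: ifP => _; last exact: (proper_ecP _ fP).
    case E: (ec f x y) => [d|] //= [<-]; case E': (ec f x y') => [d'|] //= [].
    by move=> /(can_inj (swapcK a b)) dd; apply: (proper_ecP _ fP) E _; rewrite E' dd.
  move=> y c; case: ifP => cy; apply/missesP/missesP => H w; have := H w; rewrite ef' cy //.
    move=> + fw; rewrite fw /= swapcK; exact.
  by move=> + fw; case: (ec f y w) fw => //= d [<-]; rewrite swapcK.
(* An interchange needs an edge to name its component. If [x0] lies on no edge colored [a] or [b],
   its component is a single vertex and [f] itself serves. *)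
have [[y0 ry0]|nr] : (exists y0, r x0 y0) \/ (forall y, ~~ r x0 y).
  case: (boolP [exists y, r x0 y]) => [/existsP|/existsPn]; [by left|by right].
- have memo (o : 'I_t) : (Some o \in [:: Some a; Some b]) = (o \in [:: a; b]).
    by rewrite !inE.
  have [e0 e0E] : exists e0 : edge g, val e0 = [set x0; y0].
    have: g x0 y0 by rewrite -(ec_isSome f); move: ry0; rewrite /r /chain; case: (ec f _ _).
    by rewrite -mem_edgeset => m; exists (exist (fun A => A \in edgeset g) _ m).
  have fe0 : f e0 \in [:: a; b].
    by move: ry0; rewrite /r /chain (ec_val f e0E) memo.
  have adj_conn (d d' : edge g) q : f d \in [:: a; b] -> f d' \in [:: a; b] ->
      q \in val d -> q \in val d' -> connect (ab_adj f a b) d d'.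
    move=> fd fd' qd qd'; case: (d =P d') => [->|/eqP dd]; first exact: connect0.
    apply: connect1; rewrite /ab_adj fd fd' /adjacent dd /=; apply/set0Pn; exists q.
    by rewrite inE qd.
  have to_v e : connect (ab_adj f a b) e0 e ->
      f e \in [:: a; b] /\ forall y, y \in val e -> connect r x0 y.
    have base d q : f d \in [:: a; b] -> q \in val d -> connect r x0 q ->
        forall y, y \in val d -> connect r x0 y.
      move=> fd qd cq y yd; case: (q =P y) => [<- //|nqy].
      have dE : val d = [set q; y].
        have [x1 [x2 [_ dE]]] := edge_ends d; move: qd yd; rewrite dE !inE.
        move=> /orP[]/eqP qE /orP[]/eqP yE.
        - by case: nqy; rewrite qE yE.
        - by rewrite qE yE.
        - by rewrite qE yE setUC.
        - by case: nqy; rewrite qE yE.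
      by apply: connect_trans cq (connect1 _); rewrite /r /chain (ec_val f dE) memo.
    move: e; apply: connect_ind_r.
      by split=> //; apply: (base _ x0) => //; rewrite e0E !inE eqxx.
    move=> d d' [fd cd] /and3P[_ fd' /andP[_ /set0Pn[q]]]; rewrite inE => /andP[qd qd'].
    by split=> //; apply: (base d' q) => //; apply: cd.
  have to_e y : connect r x0 y -> forall e : edge g, y \in val e -> f e \in [:: a; b] ->
      connect (ab_adj f a b) e0 e.
    move: y; apply: connect_ind_r => [e xe fe|q y IH rqy e ye fe].
      by apply: (adj_conn _ _ x0) => //; rewrite e0E !inE eqxx.
    move: rqy; rewrite /r /chain; case E: (ec f q y) => [c|//]; rewrite memo => cab.
    case/ec_someP: E => e1 e1E fe1; rewrite -fe1 in cab.
    apply: connect_trans (IH e1 _ cab) _; first by rewrite e1E !inE eqxx.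
    by apply: (adj_conn _ _ y) => //; rewrite e1E !inE eqxx orbT.
  exists (Defs.interchange f a b e0); first by apply: rt_step; exists a, b, e0.
  move=> y w; case: (boolP (g y w)) => [|ngyw]; last first.
    have := ec_isSome f y w; have := ec_isSome (Defs.interchange f a b e0) y w.
    by rewrite (negPf ngyw); case: (ec _ _ _) => // _; case: (ec _ _ _); rewrite ?if_same.
  rewrite -mem_edgeset => m; pose e : edge g := exist (fun A => A \in edgeset g) _ m.
  have : val e = [set y; w] by [].
  move: e => e eE {m}.
  rewrite !(ec_val _ eE) /= ffunE.
  case: (boolP (f e \in [:: a; b])) => [fe|nfe]; last first.
    have -> : swapc a b (f e) = f e.
      by move: nfe; rewrite !inE negb_or => /andP[? ?]; apply: swapcN.
    by rewrite !if_same.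
  have -> : connect (ab_adj f a b) e0 e = connect r x0 y.
    apply/idP/idP => [/to_v[_]|/to_e]; first by apply; rewrite eE !inE eqxx.
    by apply=> //; rewrite eE !inE eqxx.
  by case: ifP.
exists f; first exact: rt_refl.
move=> y w; case: ifP => // cy.
have -> : y = x0.
  by move: y cy; apply: connect_ind_r => // y z -> /=; rewrite (negPf (nr z)).
move: (nr w); rewrite /r /chain; case: (ec f x0 w) => [c|] //=.
by rewrite !inE negb_or => /andP[ca cb]; rewrite swapcN.
Qed.

(** A vertex missing [a] or [b] has degree at most one in the chain, and a path has only two
    ends. *)
Lemma chain_ends f a b x y z : properb f -> uniq [:: x; y; z] ->
  (forall u, u \in [:: x; y; z] -> misses f u a || misses f u b) ->
  connect (chain f a b) x y -> connect (chain f a b) x z -> False.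
Proof.
move=> fP xyz H; apply: three_ends => //; first exact: chainC.
- move=> u p q s; rewrite /chain !inE => /orP[]/eqP Ep /orP[]/eqP Eq /orP[]/eqP Es;
    by [apply: Or31; apply: (proper_ecP _ fP) Ep Eq|
        apply: Or32; apply: (proper_ecP _ fP) Ep Es|
        apply: Or33; apply: (proper_ecP _ fP) Eq Es].
- move=> u /H um p q; rewrite /chain !inE => /orP[]/eqP Ep /orP[]/eqP Eq.
  + exact: (proper_ecP _ fP) Ep Eq.
  + by case/orP: um => /missesP E; [case: (E p)|case: (E q)].
  + by case/orP: um => /missesP E; [case: (E q)|case: (E p)].
  + exact: (proper_ecP _ fP) Ep Eq.
Qed.

(** Since [b] is missing at both ends, the edge [x y] is a whole component for the colors [c] and
    [b], and a single interchange recolors it alone. *)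
Lemma recolor f x y c b : properb f -> ec f x y = Some c ->
  misses f x b -> misses f y b ->
  exists f' : coloring g t, [/\ kempe_equiv f f', properb f',
    forall p q, ec f' p q = if [set p; q] == [set x; y] then Some b else ec f p q
  & forall p d, misses f' p d =
      if p \in [:: x; y] then (d == c) || (d != b) && misses f p d else misses f p d].
Proof.
move=> fP E mx my.
have ncb : c != b by apply/eqP => cb; move/missesP: mx => /(_ y); rewrite E cb.
have E' : ec f y x = Some c by rewrite ecC.
have [f' [kf f'P ef' mf']] := swap_chain c b x fP; exists f'.
have cxp u : connect (chain f c b) x u = (u \in [:: x; y]).
  apply/idP/idP.
    move: u; apply: connect_ind_r => [|u w]; rewrite ?inE ?eqxx //.
    case/orP => /eqP->; rewrite /chain !inE => /orP[]/eqP Ew.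
    - by rewrite ((proper_ecP _ fP) _ _ _ _ Ew E) eqxx orbT.
    - by move/missesP: mx => /(_ _ Ew).
    - by rewrite ((proper_ecP _ fP) _ _ _ _ Ew E') eqxx.
    - by move/missesP: my => /(_ _ Ew).
  rewrite !inE => /orP[]/eqP->; first exact: connect0.
  by apply: connect1; rewrite /chain E !inE eqxx.
split=> // [p q|p d].
  have keep u w d : u \in [:: x; y] -> ec f u w = Some d -> [set u; w] != [set x; y] ->
      swapc c b d = d.
    rewrite !inE => uxy Ew nE; apply: swapcN; apply/eqP => dE; rewrite dE in Ew.
      case/eqP: nE; case/orP: uxy => /eqP uE; rewrite uE in Ew *.
        by rewrite ((proper_ecP _ fP) _ _ _ _ Ew E).
      by rewrite ((proper_ecP _ fP) _ _ _ _ Ew E') setUC.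
    by case/orP: uxy => /eqP uE; rewrite uE in Ew;
      [move/missesP: mx|move/missesP: my] => /(_ _ Ew).
  rewrite ef' cxp; case: (boolP (_ == _)) => [/eqP/set2_eq[][-> ->]|nE].
  - by rewrite inE eqxx E /= swapcL.
  - by rewrite !inE eqxx orbT E' /= swapcL.
  - case: ifP => // pxy; case Ep: (ec f p q) => [d|] //=.
    by rewrite (keep _ _ _ pxy Ep nE).
rewrite mf' cxp; case: ifP => // pxy.
have [mb mc] : misses f p b /\ ~~ misses f p c.
  move: pxy; rewrite !inE => /orP[]/eqP->; split=> //; apply/missesPn;
    by [exists y|exists x].
case: (eqVneq d c) => [->|dc]; first by rewrite swapcL mb.
case: (eqVneq d b) => [->|db] /=; first by rewrite swapcR (negPf mc).
by rewrite swapcN.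
Qed.

(** * Vizing fans *)

Section Fan.
Variable z : 'I_t.

(** A Vizing fan at [u] with leaves [v 0] to [v j], in which the [z]-colored edge to [v 0] plays the
    part of the usual uncolored edge. *)
Definition fan f u (v : nat -> V) j := [/\ ec f u (v 0) = Some z,
  {in [pred i | i <= j] &, injective v}
  & forall i, i < j -> exists2 a, ec f u (v i.+1) = Some a & misses f (v i) a].

Lemma adj_neq x y : g x y -> x != y.
Proof. by case: gS => _ gI; apply: contraTneq => ->; rewrite gI. Qed.

Lemma fan_adj f u v j i : fan f u v j -> i <= j -> g u (v i).
Proof.
case=> e0 _ ef; case: i => [_|i /ef[a ea _]]; first exact: ec_adj e0.
exact: ec_adj ea.
Qed.

Lemma fan_le f u v i j : i <= j -> fan f u v j -> fan f u v i.
Proof.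
move=> ij [e0 inj ef]; split=> // [p q pi qi|p pi].
  by apply: inj; [apply: leq_trans pi ij | apply: leq_trans qi ij].
by apply: ef; apply: leq_trans pi ij.
Qed.

(* Shifting the fan from its last leaf down to [v 0] recolors a single edge at a
   time, with a color missing at both ends, so other [z]-edges at the leaves do
   not interfere. *)
Lemma fan_shift f u v j a : properb f -> fan f u v j -> a != z ->
  misses f u a -> misses f (v j) a ->
  exists f' : coloring g t, [/\ kempe_equiv f f', properb f' &
    forall x, misses f' x z = [|| misses f x z, x == u | x == v 0]].
Proof.
elim: j f a => [|j IH] f a fP fanf az mu mv.
  have [e0 _ _] := fanf.
  have [f' [kf f'P _ mf']] := recolor fP e0 mu mv; exists f'; split=> // x.
  by rewrite mf' !inE eqxx; case: (x == u); case: (x == v 0); rewrite ?orbT ?orbF.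
have [e0 inj ef] := fanf; have [b eb mb] := ef j (leqnn _).
have [f1 [kf1 f1P ef1 mf1]] := recolor fP eb mu mv.
have vneq i : i <= j -> v i != v j.+1.
  by move=> ij; apply/eqP => /inj; rewrite !inE (leqW ij) => /(_ isT (leqnn _))iE;
    rewrite iE ltnn in ij.
have bz : z != b.
  apply/eqP => bz; have := vneq 0 isT.
  by rewrite ((proper_ecP _ fP) _ _ _ _ e0 (etrans eb (congr1 Some (esym bz)))) eqxx.
have un i : i <= j.+1 -> v i != u.
  by move=> ij; rewrite eq_sym; apply: adj_neq; apply: fan_adj fanf ij.
have e1 i : i <= j -> ec f1 u (v i) = ec f u (v i).
  move=> ij; rewrite ef1; case: eqP => // /set2_eq[][E1 E2].
    by have := vneq i ij; rewrite E2 eqxx.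
  by have := un i (leqW ij); rewrite E2 eqxx.
have m1 i d : i <= j -> misses f1 (v i) d = misses f (v i) d.
  by move=> ij; rewrite mf1 !inE (negPf (vneq i ij)) (negPf (un i (leqW ij))).
(* The color [b] is now missing at [u] and at [v j], so it takes the part of [a] in the fan without
   its last leaf. *)
have [||||f' [kf' f'P mf']] := IH f1 b f1P.
- split; [by rewrite e1| |].
    by move=> p q pj qj; apply: inj; rewrite inE; apply: leqW.
  move=> i ij; have [d ed md] := ef i (leqW ij); exists d; first by rewrite e1.
  by rewrite m1 // ltnW.
- by rewrite eq_sym.
- by rewrite mf1 inE !eqxx.
- by rewrite m1.
exists f'; split=> // [|x]; first exact: rt_trans kf1 kf'.
by rewrite mf' mf1 (negPf bz) [z == a]eq_sym az /= if_same.
Qed.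

(** As [u] is off the swapped chain, the colors of the fan edges stay. A leaf on the chain could
    lose a color it has to miss only if that color is [a], which is not seen at [u], or [b], which
    the last hypothesis excludes. *)
Lemma fan_swap f u v j a b : properb f -> fan f u v j ->
  misses f u a -> misses f (v j) b ->
  ~~ connect (chain f a b) (v j) u ->
  (forall i, i < j -> ec f u (v i.+1) = Some b -> ~~ connect (chain f a b) (v j) (v i)) ->
  exists f' : coloring g t, [/\ kempe_equiv f f', properb f', fan f' u v j,
    misses f' u a /\ misses f' (v j) a
  & forall y c, misses f' y c =
      misses f y (if connect (chain f a b) (v j) y then swapc a b c else c)].
Proof.
move=> fP fanf mu mv ncu ncv; have [e0 inj ef] := fanf.
have [f' [kf f'P ef' mf']] := swap_chain a b (v j) fP; exists f'.
split=> //; last by rewrite !mf' (negPf ncu) connect0 swapcL.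
split=> // [|i ij]; first by rewrite ef' (negPf ncu).
have [c ec_ mc] := ef i ij; exists c; first by rewrite ef' (negPf ncu).
rewrite mf'; case: ifP => // cvi; rewrite swapcN //; apply/eqP => cE.
  by move/missesP: mu => /(_ (v i.+1)); rewrite ec_ cE.
by move: (ncv i ij); rewrite ec_ cE => /(_ erefl); rewrite cvi.
Qed.

(** If each leaf reached misses a color other than [z], following such colors from leaf to leaf
    meets a color missing at [u] or runs into a loop. Either way, after at most one chain swap, the
    fan can be shifted. *)
Lemma vizing_fan f u v0 a : properb f -> ec f u v0 = Some z -> misses f u a ->
  (exists f' : coloring g t, [/\ kempe_equiv f f', properb f' &
     forall x, misses f' x z = [|| misses f x z, x == u | x == v0]]) \/
  (exists v j, [/\ fan f u v j, v 0 = v0 & forall c, misses f (v j) c -> c = z]).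
Proof.
move=> fP e0 mu.
have az : a != z by apply/eqP => aE; move/missesP: mu => /(_ v0); rewrite e0 aE.
(* Paths of [R] from [v0] without repeated vertices are exactly the fans starting at [v0], so
   reachability ranges over all possible leaves. *)
pose R x y := [exists c, (ec f u y == Some c) && misses f x c].
have to_fan x : connect R v0 x -> exists v j, [/\ fan f u v j, v 0 = v0 & v j = x].
  case/connectP => q0 q0P xE; case/shortenP: q0P xE => q qP uq _ xE.
  exists (nth v0 (v0 :: q)), (size q); split=> //; last by rewrite xE (last_nth v0).
  split=> // [i j|i iq].
    by rewrite !inE => ij jj /eqP; rewrite nth_uniq // => /eqP.
  move/pathP: qP => /(_ v0 i iq)/existsP[c /andP[/eqP E1 E2]].
  by exists c.
case: (boolP [exists x, connect R v0 x && [forall c, misses f x c ==> (c == z)]]).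
  case/existsP=> x /andP[/to_fan[v [j [fv v0E vj]]] /forallP H]; right; exists v, j.
  by split=> // c; rewrite vj => mc; apply/eqP; apply: (implyP (H c)).
move/existsPn => nB; left.
case: (boolP [exists x, exists c, [&& connect R v0 x, c != z, misses f x c & misses f u c]]).
  case/existsP=> x /existsP[c /and4P[/to_fan[v [j [fv v0E vj]]] cz mx mc]].
  by rewrite -vj in mx; rewrite -v0E; apply: fan_shift fP fv cz mc mx.
move/existsPn => nA.
pose m x := odflt z [pick c | (c != z) && misses f x c].
pose nxt x := odflt x [pick y | ec f u y == Some (m x)].
have mP x : connect R v0 x -> m x != z /\ misses f x (m x).
  move=> cx; rewrite /m; case: pickP => [c /andP[]//|no].
  have := nB x; rewrite cx /= => /forallPn[c]; rewrite negb_imply => /andP[mc cz].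
  by have := no c; rewrite cz mc.
have nP x : connect R v0 x -> ec f u (nxt x) = Some (m x).
  move=> cx; have [mz mm] := mP x cx; rewrite /nxt; case: pickP => [y /eqP//|no].
  have /existsPn/(_ (m x)) := nA x; rewrite cx mz mm /= => /missesPn[y Ey].
  by have := no y; rewrite Ey eqxx.
have cn x : connect R v0 x -> connect R v0 (nxt x).
  move=> cx; apply: (connect_trans cx); apply: connect1; apply/existsP; exists (m x).
  by rewrite nP // eqxx; case: (mP x cx).
pose v i := iter i nxt v0.
have cv i : connect R v0 (v i) by elim: i => [|i IH]; [exact: connect0|exact: cn].
have ev i : ec f u (v i.+1) = Some (m (v i)) by exact: nP.
have [N NE] : exists N, order nxt v0 = N.+1.
  by exists (order nxt v0).-1; rewrite prednK // order_gt0.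
have vinj i j : i <= N -> j <= N -> v i = v j -> i = j.
  move=> iN jN vE; apply/eqP.
  rewrite -(nth_uniq v0 _ _ (orbit_uniq nxt v0)) ?size_orbit ?NE ?ltnS //.
  by rewrite /orbit NE !nth_traject // -/(v i) -/(v j) vE.
have fanN : fan f u v N.
  split=> // i iN.
  by exists (m (v i)); [exact: ev|case: (mP _ (cv i))].
have := looping_order nxt v0; rewrite NE => /trajectP[l lN].
rewrite -/(v N.+1) -/(v l) => vE.
(* The loop cannot return to [v0], whose edge has color [z]. It returns to [v l.+1], so [v l] and
   [v N] both miss the color [b] of that edge. *)
case: l lN vE => [|l] lN vE.
  have := ev N; rewrite vE e0 => -[zE].
  by case: (mP _ (cv N)); rewrite -zE eqxx.
have mE : m (v N) = m (v l) by have := ev N; rewrite vE ev => -[].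
have [bz mvl] := mP _ (cv l); have [_ mvN] := mP _ (cv N); rewrite mE in mvN.
set b := m (v l) in bz mvl mvN mE.
have col_b i : i < N -> ec f u (v i.+1) = Some b -> i = l.
  move=> iN /((proper_ecP _ fP) _ _ _ _ (ev l))/esym/vinj.
  by move=> /(_ iN lN)[].
(* Swapping the chain of [v j] makes [a] missing at both [u] and [v j], after which the fan is
   shifted. Neither [a] nor [b] is [z], so the swap does not affect which vertices see [z]. *)
have finish j : j <= N -> misses f (v j) b -> ~~ connect (chain f a b) (v j) u ->
    (l < j -> ~~ connect (chain f a b) (v j) (v l)) ->
    exists f' : coloring g t, [/\ kempe_equiv f f', properb f' &
     forall x, misses f' x z = [|| misses f x z, x == u | x == v0]].
  move=> jN mj ncu ncl.
  have [i ij /(col_b _ (leq_trans ij jN)) iE|f1 [kf1 f1P fan1 [m1 m1'] mf1]] :=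
    fan_swap fP (fan_le jN fanN) mu mj ncu.
    by rewrite iE in ij *; apply: ncl.
  have [f2 [kf2 f2P mf2]] := fan_shift f1P fan1 az m1 m1'.
  exists f2; split=> // [|x]; first exact: rt_trans kf1 kf2.
  by rewrite mf2 mf1 swapcN 1?eq_sym // if_same.
have lN' : l <= N by apply: ltnW.
(* The vertices [u], [v l] and [v N] are all ends of chains, so they are not all on one. If [u] is
   on the chain of [v l], then the chain of [v N] avoids both. *)
case: (boolP (connect (chain f a b) (v l) u)) => [clu|nclu]; last first.
  by apply: (finish l) => //; rewrite ltnn.
have chC : connect_sym (chain f a b) by apply: sym_connect_sym; apply: chainC.
have nN : ~~ connect (chain f a b) (v N) u.
  apply/negP => cNu; apply: (@chain_ends f a b u (v l) (v N)) => //.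
  - rewrite /= !inE negb_or !(@adj_neq u) ?(fan_adj fanN) //= andbT.
    by apply/eqP => /vinj => /(_ lN' (leqnn _)) lE; rewrite lE ltnn in lN.
  - by move=> w; rewrite !inE => /or3P[]/eqP->; rewrite ?mu ?mvl ?mvN ?orbT.
  - by rewrite chC.
  - by rewrite chC.
apply: (finish N) => // _; apply: contra nN => cNl.
exact: connect_trans cNl clu.
Qed.

End Fan.
End VertexView.

(** * Eliminating a color by Kempe changes *)

Section Reduction.
Variables (V : finType) (g : rel V) (t : nat).
Hypothesis gS : simple_graph g.
Implicit Type f : coloring g t.

Lemma card_seen f x : #|[set c | ~~ misses f x c]| <= deg g x.
Proof.
rewrite -(card_imset _ (@Some_inj _)).
apply: leq_trans (leq_imset_card (ec f x) [set y | g x y]).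
apply: subset_leq_card; apply/subsetP => o /imsetP[c]; rewrite inE => /missesPn[y Ey] ->.
by rewrite -Ey; apply: imset_f; rewrite inE; apply: (ec_adj gS) Ey.
Qed.

Lemma misses_other f x z : (deg g x).+1 < t -> exists2 c, c != z & misses f x c.
Proof.
move=> dx; case: (pickP [pred c | (c != z) && misses f x c]) => [c /andP[]|no]; first by exists c.
have: [set: 'I_t] \subset z |: [set c | ~~ misses f x c].
  apply/subsetP => c _; rewrite !inE; have := no c => /=.
  by case: eqP => //= _ ->.
move/subset_leq_card; rewrite cardsT card_ord => le_t.
have := leq_trans le_t (leq_trans (leq_card_setU _ _) (leq_add (leqnn _) (card_seen f x))).
by rewrite cards1 add1n leqNgt dx.
Qed.

Lemma misses_some f x : deg g x < t -> exists c, misses f x c.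
Proof.
move=> dx; case: (pickP (misses f x)) => [c|no]; first by exists c.
have: [set: 'I_t] \subset [set c | ~~ misses f x c].
  by apply/subsetP => c _; rewrite !inE no.
move/subset_leq_card; rewrite cardsT card_ord => /leq_trans/(_ (card_seen f x)).
by rewrite leqNgt dx.
Qed.

Section Color.
Variable z : 'I_t.

Definition seeing f := [set x | ~~ misses f x z].

Lemma seeing_drop f f' u v :
  (forall x, misses f' x z = [|| misses f x z, x == u | x == v]) ->
  u != v -> u \in seeing f -> v \in seeing f ->
  #|seeing f'|.+2 = #|seeing f|.
Proof.
move=> mf' uv us vs; rewrite (cardsD1 u (seeing f)) us.
rewrite (cardsD1 v (seeing f :\ u)) in_setD1 vs [v == u]eq_sym uv.
rewrite add1n add1n; congr _.+2; apply: eq_card => x; rewrite !inE mf'.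
by rewrite !negb_or; case: (x == u); case: (x == v); rewrite /= ?andbF ?andbT.
Qed.

(** Every leaf has degree below [t - 1] and hence misses a color besides [z], which rules out the
    bad outcome of [vizing_fan]. Both ends of the recolored edge stop seeing [z]. *)
Lemma reduce_at f u : properb f -> deg g u < t ->
  (forall y, g u y -> (deg g y).+1 < t) -> ~~ misses f u z ->
  exists f' : coloring g t,
    [/\ kempe_equiv f f', properb f' & #|seeing f'| < #|seeing f|.-1].
Proof.
move=> fP du dn /missesPn[v0 e0]; have [a mu] := misses_some f du.
case: (vizing_fan gS fP e0 mu) => [[f' [kf f'P mf']]|[v [j [fanf v0E only_z]]]].
  exists f'; split=> //.
  have <- := seeing_drop mf' (adj_neq gS (ec_adj gS e0)) => //.
    by rewrite inE; apply/missesPn; exists v0.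
  by rewrite inE; apply/missesPn; exists u; rewrite ecC.
have [c cz mc] := misses_other f z (dn _ (fan_adj gS fanf (leqnn _))).
by rewrite (only_z _ mc) eqxx in cz.
Qed.

(** In the bad case the last leaf [w] has degree [t - 1], so all neighbors of [w] have smaller
    degree and [reduce_at] applies at [w] once a swap makes [w] see [z]. What remains is to count
    how many vertices that preparation adds. *)
Lemma reduce_step f x0 : properb f -> (forall x, deg g x < t) ->
  (forall x y, g x y -> ((deg g x).+1 < t) || ((deg g y).+1 < t)) ->
  x0 \in seeing f ->
  exists f' : coloring g t,
    [/\ kempe_equiv f f', properb f' & #|seeing f'| < #|seeing f|].
Proof.
move=> fP dt indep; rewrite inE => /missesPn[v0 e0].
have [a mu] := misses_some f (dt x0); set u := x0 in e0 mu.
have az : a != z by apply/eqP => aE; move/missesP: mu => /(_ v0); rewrite e0 aE.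
have us : u \in seeing f by rewrite inE; apply/missesPn; exists v0.
have v0s : v0 \in seeing f by rewrite inE; apply/missesPn; exists u; rewrite ecC.
have uv0 : u != v0 := adj_neq gS (ec_adj gS e0).
case: (vizing_fan gS fP e0 mu) => [[f' [kf f'P mf']]|[v [j [fanf v0E only_z]]]].
  by exists f'; split=> //; rewrite -(seeing_drop mf').
set w := v j in only_z.
have mw : misses f w z by have [c mc] := misses_some f (dt w); rewrite -(only_z _ mc).
have ma : ~~ misses f w a by apply/negP => /only_z aE; rewrite aE eqxx in az.
have dw y : g w y -> (deg g y).+1 < t.
  move/indep => /orP[/(misses_other f z)[c cz /only_z cE]|//].
  by rewrite cE eqxx in cz.
have uw : u != w := adj_neq gS (fan_adj gS fanf (leqnn _)).
have wv0 : w != v0 by apply: contraTneq v0s => <-; rewrite inE mw.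
(* Since [w] misses [z], it is one end of its chain, which leaves room for at most one other end. *)
have ends y : y != w -> misses f y a || misses f y z ->
    connect (chain f a z) w y -> forall y', y' != w -> misses f y' a || misses f y' z ->
    connect (chain f a z) w y' -> y = y'.
  move=> yw my cy y' y'w my' cy'; apply/eqP/negPn/negP => yy'.
  apply: (@chain_ends _ _ _ gS f a z w y y') => //.
    by rewrite /= !inE negb_or ![w == _]eq_sym yw y'w yy'.
  by move=> s; rewrite !inE => /or3P[]/eqP->; rewrite ?mw ?orbT.
case: (boolP (connect (chain f a z) w u)) => [cwu|ncwu].
  have [f1 [kf1 f1P _ mf1]] := swap_chain gS a z w fP.
  have w1 : ~~ misses f1 w z by rewrite mf1 connect0 swapcR.
  have [f2 [kf2 f2P lt2]] := reduce_at f1P (dt w) dw w1.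
  exists f2; split=> //; first exact: rt_trans kf1 kf2.
  (* [u] and [w] are the two ends of one chain, so they just exchange roles. *)
  have E : seeing f1 = w |: (seeing f :\ u).
    apply/setP => y; rewrite !inE mf1.
    case: (eqVneq y w) => [->|yw] /=; first by rewrite connect0 swapcR ma.
    case: ifP => cy; last by case: eqVneq => // yu; rewrite yu cwu in cy.
    rewrite swapcR; case: (eqVneq y u) => [->|yu] /=; first by rewrite mu.
    have : ~~ (misses f y a || misses f y z).
      by apply: contra yu => my; apply/eqP; apply: (ends y) => //; rewrite mu.
    by case/norP => -> ->.
  move: lt2; rewrite E cardsU1 !inE mw andbF /= add0n => /leq_trans; apply.
  by apply: subset_leq_card; apply: subsetDl.
(* Only [v 0] is joined to [u] by color [z], so the extra condition of [fan_swap] holds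
   vacuously. *)
have az_fan i : i < j -> ec f u (v i.+1) = Some z -> ~~ connect (chain f a z) w (v i).
  move=> ij E; have [e0' inj _] := fanf.
  have := (proper_ecP gS _ fP) _ _ _ _ E e0'.
  by move/inj; rewrite !inE => /(_ ij isT).
have [f1 [kf1 f1P fan1 [m1 m1'] mf1]] := fan_swap gS fP fanf mu mw ncwu az_fan.
have [f2 [kf2 f2P mf2]] := fan_shift gS f1P fan1 az m1 m1'.
rewrite -/w in mf1 m1'; rewrite v0E in mf2.
have w2 : ~~ misses f2 w z.
  by rewrite mf2 mf1 connect0 swapcR !negb_or ma eq_sym uw wv0.
have [f3 [kf3 f3P lt3]] := reduce_at f2P (dt w) dw w2.
exists f3; split=> //; first exact: rt_trans kf1 (rt_trans _ _ _ _ _ kf2 kf3).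
apply: leq_trans lt3 _.
have [e01 _ _] := fan1; rewrite v0E in e01.
have drop2 : #|seeing f2|.+2 = #|seeing f1|.
  by apply: (seeing_drop mf2) => //; rewrite inE; apply/missesPn;
    [exists v0|exists u; rewrite ecC].
pose D := [set y | (connect (chain f a z) w y && misses f y z) && (y != w)].
have sub : seeing f1 \subset seeing f :|: (w |: D).
  apply/subsetP => y; rewrite !inE mf1.
  case: (boolP (misses f y z)) => // my; case: (boolP (connect _ _ _)) => //= [cy _|_].
    by case: (eqVneq y w).
  by rewrite my.
(* The swap adds at most two vertices seeing [z], the ends of the chain of [w],
   and the shift of the fan at [u] removes two. *)
have D1 : #|D| <= 1.
  apply/card_le1_eqP => y y'; rewrite !inE => /andP[/andP[cy my] yw] /andP[/andP[cy' my'] yw'].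
  by apply: ends; rewrite ?my ?my' ?orbT.
have := leq_trans (subset_leq_card sub) (leq_card_setU _ _).
rewrite -drop2 => le2; have le3 : #|w |: D| <= 2.
  by apply: leq_trans (leq_card_setU _ _) _; rewrite cards1 add1n ltnS.
have := leq_trans le2 (leq_add (leqnn _) le3); rewrite addn2 !ltnS.
by move=> ?; apply: leq_trans (leq_pred _) _.
Qed.

Lemma eliminate_color f : properb f -> (forall x, deg g x < t) ->
  (forall x y, g x y -> ((deg g x).+1 < t) || ((deg g y).+1 < t)) ->
  exists f' : coloring g t,
    [/\ kempe_equiv f f', properb f' & forall x, misses f' x z].
Proof.
move=> + dt indep; move: {2}_.+1 (ltnSn #|seeing f|) => n.
elim: n f => // n IH f; rewrite ltnS => fn fP.
case: (set_0Vmem (seeing f)) => [E|[x xs]].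
  exists f; split=> // [|x]; first exact: rt_refl.
  by apply/negPn/negP => mx; have := in_set0 x; rewrite -E inE mx.
have [f1 [kf1 f1P lt1]] := reduce_step fP dt indep xs.
have [f2 [kf2 f2P m2]] := IH f1 (leq_trans lt1 fn) f1P.
by exists f2; split=> //; apply: rt_trans kf1 kf2.
Qed.

End Color.
End Reduction.

(** * Removing a matching and recoloring it with one color *)

Definition differ_by_matching (V : finType) (g h : rel V) : Prop :=
  subrel h g /\ forall x y y', g x y -> ~~ h x y -> g x y' -> ~~ h x y' -> y = y'.

(** The edges to be recolored do not interfere: an edge already colored [z] belongs to the matching,
    so it cannot share an end with another matching edge. *)
Lemma recolor_matching (V : finType) (g h : rel V) (t : nat) (z : 'I_t)
    (f : coloring g t) :
  simple_graph g -> symmetric h -> differ_by_matching g h -> properb f ->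
  (forall x y, ec f x y = Some z -> ~~ h x y) ->
  exists f' : coloring g t, [/\ kempe_equiv f f', properb f' & forall x y,
    ec f' x y = if g x y && ~~ h x y then Some z else ec f x y].
Proof.
move=> gS hC [sub mat].
pose bad (f : coloring g t) :=
  [set p : V * V | [&& g p.1 p.2, ~~ h p.1 p.2 & ec f p.1 p.2 != Some z]].
move: {2}_.+1 (ltnSn #|bad f|) => n.
elim: n f => // n IH f; rewrite ltnS => fn fP fz.
case: (set_0Vmem (bad f)) => [E|[[x y]]].
  exists f; split=> // [|x y]; first exact: rt_refl.
  case: ifP => // gh; have := in_set0 (x, y).
  by rewrite -E inE /= andbA gh => /negbT/negPn/eqP.
rewrite inE /= => /and3P[gxy nhxy exy].
have gyx : g y x by case: gS => <-.
have nhyx : ~~ h y x by rewrite hC.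
have mx : misses f x z.
  apply/missesP => y' E; have := mat _ _ _ gxy nhxy (ec_adj gS E) (fz _ _ E) => yy.
  by rewrite yy E eqxx in exy.
have my : misses f y z.
  apply/missesP => y' E; have := mat _ _ _ gyx nhyx (ec_adj gS E) (fz _ _ E) => yy.
  by rewrite ecC yy E eqxx in exy.
have: (ec f x y : bool) by rewrite ec_isSome.
case E: (ec f x y) => [c|//] _.
have [f1 [kf1 f1P ef1 _]] := recolor gS fP E mx my.
have sameh p q : [set p; q] = [set x; y] -> ~~ h p q.
  by case/set2_eq=> -[-> ->].
have [||f2 [kf2 f2P ef2]] := IH f1 _ f1P.
- apply: leq_trans fn; apply: proper_card; apply/properP; split.
    apply/subsetP => -[p q]; rewrite !inE /= ef1; case/and3P=> -> ->.
    by case: ifP => // _; rewrite eqxx.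
  by exists (x, y); rewrite !inE /= ?gxy ?nhxy ?exy // ef1 !eqxx.
- by move=> p q; rewrite ef1; case: eqP => [/sameh//|_ /fz].
exists f2; split=> // [|p q]; first exact: rt_trans kf1 kf2.
rewrite ef2; case: ifP => // gh; rewrite ef1; case: eqP => // pq.
move: gh; rewrite (sameh _ _ pq) andbT -(mem_edgeset gS) pq mem_edgeset //.
by rewrite gxy.
Qed.

(** * Extending colorings over a removed matching *)

Section Lift.
Variables (V : finType) (g h : rel V) (n : nat).
Hypotheses (gS : simple_graph g) (hS : simple_graph h) (gh : differ_by_matching g h).
Implicit Type F : coloring h n.

Let wd : 'I_n -> 'I_n.+1 := widen_ord (leqnSn n).

Lemma wd_inj : injective wd.
Proof. by move=> a b /(congr1 val)/= /val_inj. Qed.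

Lemma edgeset_sub (A : {set V}) : A \in edgeset h -> A \in edgeset g.
Proof.
case: gh => sub _; rewrite !inE => /existsP[x /existsP[y /andP[hxy E]]].
by apply/existsP; exists x; apply/existsP; exists y; rewrite sub.
Qed.

Definition widen_edge (e : edge h) : edge g :=
  exist (fun A => A \in edgeset g) (val e) (edgeset_sub (valP e)).

Definition lift_coloring F : coloring g n.+1 :=
  [ffun e : edge g => if insub (val e) is Some e' then wd (F e') else ord_max].

Lemma lift_widen F e : lift_coloring F (widen_edge e) = wd (F e).
Proof. by rewrite ffunE /= valK. Qed.

Lemma wd_max a : wd a <> ord_max.
Proof. by move/(congr1 val) => /= E; have := ltn_ord a; rewrite E ltnn. Qed.

Lemma lift_small F e a : lift_coloring F e = wd a -> exists e', e = widen_edge e'.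
Proof.
rewrite ffunE; case: insubP => [e' _ eE _|_ /esym/wd_max//].
by exists e'; apply: val_inj; rewrite /= eE.
Qed.

Lemma ec_lift F x y :
  ec (lift_coloring F) x y = if h x y then omap wd (ec F x y)
                    else if g x y then Some ord_max else None.
Proof.
rewrite -(mem_edgeset gS) -(mem_edgeset hS) /ec.
case: insubP => [e me eE|/negPf me] /=.
  rewrite ffunE eE me; case: insubP => [e' -> _ //|/negPf-> //].
rewrite me; case: ifP => // mh.
by rewrite (edgeset_sub mh) in me.
Qed.

(** The matching carries only the new color [ord_max], so components in two old colors are the same
    in [g] as in [h]. *)
Lemma lift_step F F' : kempe_step F F' -> kempe_step (lift_coloring F) (lift_coloring F').
Proof.
case=> a [b [e0 ->]]; exists (wd a), (wd b), (widen_edge e0).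
have memw c : (wd c \in [:: wd a; wd b]) = (c \in [:: a; b]).
  by rewrite !inE !(inj_eq wd_inj).
have adjw e e' :
    ab_adj (lift_coloring F) (wd a) (wd b) (widen_edge e) (widen_edge e') =
    ab_adj F a b e e'.
  by rewrite /ab_adj !lift_widen !memw.
have conn e : connect (ab_adj (lift_coloring F) (wd a) (wd b)) (widen_edge e0) e <->
    exists2 e', e = widen_edge e' & connect (ab_adj F a b) e0 e'.
  split.
    move: e; apply: connect_ind_r; first by exists e0; rewrite ?connect0.
    move=> d d' [e -> ce] adj.
    have [e' dE] : exists e', d' = widen_edge e'.
      case/and3P: adj => _ + _; rewrite !inE => /orP[]/eqP; exact: lift_small.
    exists e' => //; rewrite dE adjw in adj.
    exact: connect_trans ce (connect1 adj).
  case=> e' ->; move: e'; apply: connect_ind_r; first exact: connect0.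
  by move=> d d' cd; rewrite -adjw => /connect1; apply: connect_trans.
apply/ffunP => e; rewrite [RHS]ffunE [LHS]ffunE.
case: insubP => [e' me eE|me].
  have eE' : e = widen_edge e' by apply: val_inj; rewrite /= eE.
  rewrite eE' lift_widen ffunE.
  have -> : connect (ab_adj (lift_coloring F) (wd a) (wd b)) (widen_edge e0) (widen_edge e') =
            connect (ab_adj F a b) e0 e'.
    apply/idP/idP => [/conn[d dE]|ce]; last by apply/conn; exists e'.
    suff -> : e' = d by [].
    by apply: val_inj; move/(congr1 val): dE.
  case: ifP => // _; rewrite /swapc !(inj_eq wd_inj).
  by do 2?case: ifP.
case: ifP => [/conn[d dE _]|_]; first by case/negP: me; rewrite dE; exact: (valP d).
by rewrite ffunE insubN.
Qed.

Lemma lift_equiv F F' : kempe_equiv F F' -> kempe_equiv (lift_coloring F) (lift_coloring F').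
Proof.
elim=> [F1 F2 /lift_step|F1|F1 F2 F3 _ ? _ ?]; first exact: rt_step.
  exact: rt_refl.
by apply: rt_trans; eassumption.
Qed.

Lemma lift_proper F : properb F -> properb (lift_coloring F).
Proof.
have [_ mat] := gh; move=> FP; apply/(proper_ecP gS) => x y y' c.
rewrite !ec_lift; case: (boolP (h x y)) => hxy; case: (boolP (h x y')) => hxy'.
- case E: (ec F x y) => [d|] //= [<-]; case E': (ec F x y') => [d'|] //=.
  by move=> /Some_inj/wd_inj dd; apply: (proper_ecP hS _ FP) E _; rewrite E' dd.
- case: (ec F x y) => [d|] //= [<-]; case: ifP => // _ /Some_inj/esym/wd_max[].
- by case: ifP => // _ [<-]; case: (ec F x y') => [d|] //= /Some_inj/wd_max[].
- by do 2!case: ifP => // ? _; apply: (mat x).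
Qed.

(** When the last color class is exactly the removed matching, all edges of [h] have colors below
    [n], so the coloring is a lift. *)
Lemma restrict (f : coloring g n.+1) : properb f ->
  (forall x y, g x y -> (ec f x y == Some ord_max) = ~~ h x y) ->
  exists2 F, properb F & lift_coloring F = f.
Proof.
move=> fP fh; have [sub _] := gh.
have small e : f (widen_edge e) < n.
  have [x [y [hxy eE]]] := edge_ends e.
  rewrite ltn_neqAle -ltnS ltn_ord andbT; apply/eqP => fE.
  have := fh x y (sub _ _ hxy).
  rewrite (@ec_val _ _ _ f (widen_edge e) x y eE) hxy => /eqP; apply.
  by congr Some; apply: val_inj.
pose F : coloring h n := [ffun e => Ordinal (small e)].
have lF : lift_coloring F = f.
  apply: eq_ec => x y; rewrite ec_lift.
  case: ifP => hxy.
    have: (ec F x y : bool) by rewrite ec_isSome.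
    case E: (ec F x y) => [c|//] _; case/ec_someP: E => e eE Fe.
    rewrite (@ec_val _ _ _ f (widen_edge e) x y eE) -Fe /= ffunE.
    by congr Some; apply: val_inj.
  case: ifP => gxy; first by apply/esym/eqP; rewrite fh // hxy.
  by have := ec_isSome gS f x y; rewrite gxy; case: (ec f x y).
exists F => //; apply/(proper_ecP hS) => x y y' c E E'.
have hE w : ec F x w = Some c -> ec f x w = Some (wd c).
  by move=> Ew; rewrite -lF ec_lift (ec_adj hS Ew) Ew.
exact: (proper_ecP gS _ fP) (hE _ E) (hE _ E').
Qed.

Lemma has_coloring_lift : has_coloring h n -> has_coloring g n.+1.
Proof. by case/existsP=> F FP; apply/existsP; exists (lift_coloring F); apply: lift_proper. Qed.

Lemma transfer :
  (forall F1 F2 : coloring h n, properb F1 -> properb F2 -> kempe_equiv F1 F2) ->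
  (forall x, deg g x <= n) ->
  (forall x y, g x y -> (deg g x < n) || (deg g y < n)) ->
  forall f1 f2 : coloring g n.+1, properb f1 -> properb f2 -> kempe_equiv f1 f2.
Proof.
move=> eqF dg indep.
(* Clear the last color, give it to the whole matching, and restrict the result to [h]. *)
have to_lift (f : coloring g n.+1) : properb f ->
    exists2 F, properb F & kempe_equiv f (lift_coloring F).
  move=> fP; have [f1 [kf1 f1P m1]] := eliminate_color gS ord_max fP dg indep.
  have [||f2 [kf2 f2P ef2]] := @recolor_matching _ g h _ ord_max f1 gS _ gh f1P.
  - by case: hS.
  - by move=> x y E; move/missesP: (m1 x) => /(_ _ E).
  have [x y gxy|F FP FE] := restrict f2P.
    rewrite ef2 gxy /=; case: (h x y) => //=; last by rewrite eqxx.
    by apply/eqP => E; move/missesP: (m1 x) => /(_ _ E).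
  by exists F => //; rewrite FE; apply: rt_trans kf1 kf2.
move=> f1 f2 /to_lift[F1 F1P k1] /to_lift[F2 F2P /kempe_equiv_sym k2].
exact: rt_trans k1 (rt_trans _ _ _ _ _ (lift_equiv (eqF _ _ F1P F2P)) k2).
Qed.
End Lift.

(** * Chromatic index, maximum degree and maximal matchings *)

Section Index.
Variables (V : finType) (g : rel V).
Hypothesis gS : simple_graph g.

Lemma differ_refl : differ_by_matching g g.
Proof. by split=> // x y y' ->. Qed.

(** Once the last color is eliminated, restricting along the empty matching leaves a coloring with
    one color fewer. *)
Lemma has_coloring_drop t : has_coloring g t.+1 ->
  (forall x, deg g x <= t) ->
  (forall x y, g x y -> (deg g x < t) || (deg g y < t)) -> has_coloring g t.
Proof.
case/existsP=> f fP dg indep.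
have [f1 [_ f1P m1]] := eliminate_color gS ord_max fP dg indep.
have [x y gxy|F FP _] := restrict gS gS differ_refl f1P; last by apply/existsP; exists F.
by rewrite gxy; apply/eqP => E; move/missesP: (m1 x) => /(_ _ E).
Qed.

Lemma has_coloring_le m n : m <= n -> has_coloring g m -> has_coloring g n.
Proof.
move/subnKC <-; elim: (n - m) => [|d IH]; first by rewrite addn0.
by rewrite addnS => /IH; apply: has_coloring_lift differ_refl.
Qed.

Lemma deg_le_coloring t x : has_coloring g t -> deg g x <= t.
Proof.
case/existsP=> f fP; rewrite -[X in _ <= X]card_ord -cardsT.
rewrite -(card_imset _ (@Some_inj _)).
have inj : {in [set u | g x u] &, injective (ec f x)}.
  move=> u w; rewrite !inE => gu gw E.
  have: (ec f x u : bool) by rewrite ec_isSome.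
  case Eu: (ec f x u) => [c|//] _.
  by apply: (proper_ecP gS _ fP) (Eu) _; rewrite -E.
rewrite /deg -(card_in_imset inj); apply: subset_leq_card.
apply/subsetP => o /imsetP[u]; rewrite inE => gu ->.
have: (ec f x u : bool) by rewrite ec_isSome.
by case: (ec f x u) => [c|//] _; apply: imset_f; rewrite inE.
Qed.

Lemma chromatic_index_eq n : has_coloring g n ->
  (forall m, m < n -> ~~ has_coloring g m) -> chromatic_index g = n.
Proof.
move=> gn min.
(* Giving each edge its own color is proper, so [n] lies in the range searched by [find]. *)
have nE : n <= #|{: edge g}|.
  rewrite leqNgt; apply/negP => /min/negP; apply.
  apply/existsP; exists [ffun e => enum_rank e].
  apply/forallP => e; apply/forallP => e'; apply/implyP => /andP[ee' _].
  by rewrite !ffunE (inj_eq enum_rank_inj).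
apply/eqP; rewrite eqn_leq /chromatic_index; apply/andP; split; rewrite leqNgt; apply/negP.
  by move/(before_find 0); rewrite nth_iota ?ltnS // add0n gn.
set F := find _ _ => Fn; have /negP := min _ Fn; apply.
have Fs : F < #|{: edge g}|.+1 by rewrite ltnS; apply: leq_trans (ltnW Fn) nE.
have := @nth_find _ 0 (fun t => has_coloring g t) (iota 0 #|{: edge g}|.+1).
by rewrite -/F nth_iota // add0n; apply; rewrite has_find size_iota.
Qed.

Lemma lt_chromatic_index m : m < chromatic_index g -> ~~ has_coloring g m.
Proof.
move=> lt_m; have := @before_find _ 0 _ _ _ lt_m.
rewrite nth_iota ?add0n => [->//|].
by apply: leq_trans lt_m _; rewrite -[X in _ <= X](size_iota 0); apply: find_size.
Qed.

Lemma deg_le_Delta x : deg g x <= Delta g.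
Proof. exact: (leq_bigmax x). Qed.

Lemma Delta_attained : 0 < Delta g -> exists x, deg g x = Delta g.
Proof.
move=> D0; case: (pickP [pred x | deg g x == Delta g]) => [x /eqP|no]; first by exists x.
suff: Delta g <= (Delta g).-1 by case: (Delta g) D0 => // d _; rewrite ltnn.
apply/bigmax_leqP => x _; rewrite -ltnS prednK // ltn_neqAle deg_le_Delta andbT.
by have /= -> := no x.
Qed.

(** Matchings are sets of pairwise disjoint edges, and the last clause expresses maximality: every
    edge of [g] has an end covered by a removed edge. *)
Lemma maximal_matching : exists h : rel V,
  [/\ simple_graph h, differ_by_matching g h &
   forall x y, g x y -> (exists2 w, g x w & ~~ h x w) \/ (exists2 w, g y w & ~~ h y w)].
Proof.
have [gC gI] := gS.
pose P (M : {set {set V}}) := (M \subset edgeset g) && trivIset M.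
have P0 : P set0.
  by rewrite /P sub0set; apply/trivIsetP => A B; rewrite inE.
have [M /maxsetP[/andP[sM tM] maxM] _] := maxset_exists P0.
exists (fun x y => g x y && ([set x; y] \notin M)).
have same x y y' : [set x; y] \in M -> [set x; y'] \in M -> g x y -> y = y'.
  move=> m m' gxy; have : [set x; y] = [set x; y'].
    apply/eqP/negPn/negP => ne.
    have /trivIsetP/(_ _ _ m m' ne) := tM.
    by move/disjoint_setI0/setP/(_ x); rewrite !inE eqxx.
  by case/set2_eq=> [[_ //]|[-> ->]].
split.
- split=> [x y|x]; first by rewrite gC setUC.
  by rewrite gI.
- split=> [x y /andP[]//|x y y' gxy].
  rewrite gxy /= => /negPn m gxy'; rewrite gxy' /= => /negPn m'.
  exact: same m m' gxy.
- move=> x y gxy.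
  have cover w A : A \in M -> w \in A -> exists2 v, g w v & ~~ (g w v && ([set w; v] \notin M)).
    move=> AM wA; have := subsetP sM _ AM; rewrite inE.
    case/existsP=> a /existsP[b /andP[gab /eqP AE]].
    move: wA; rewrite AE !inE => /orP[]/eqP->.
      by exists b; rewrite ?gab //= -AE AM.
    by exists a; rewrite gC ?gab //= setUC -AE AM.
  case: (boolP [exists A in M, x \in A]) => [/existsP[A /andP[AM xA]]|/existsPn nx].
    by left; apply: cover xA.
  case: (boolP [exists A in M, y \in A]) => [/existsP[A /andP[AM yA]]|/existsPn ny].
    by right; apply: cover yA.
  (* An edge with both ends uncovered could be added to [M], against maximality. *)
  have dis A : A \in M -> [disjoint [set x; y] & A].
    move=> AM; rewrite -setI_eq0; apply/eqP/setP => w; rewrite !inE.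
    have := nx A; have := ny A; rewrite AM /= => yA xA.
    by case: (w =P x) => [->|_] /=; [apply: negPf|case: (w =P y) => [->|//]; apply: negPf].
  have n0 : set0 \notin M.
    apply/negP => /(subsetP sM); rewrite inE => /existsP[a /existsP[b /andP[_ /eqP/setP/(_ a)]]].
    by rewrite !inE eqxx.
  have [tM' xyM] := trivIsetU1 dis tM n0.
  have PM' : P ([set x; y] |: M).
    by rewrite /P tM' andbT subUset sub1set mem_edgeset // gxy.
  by move: xyM; rewrite -{1}(maxM _ PM' (subsetUr _ _)) setU11.
Qed.
End Index.

(** * Degrees after the removal of a matching *)

Section DegMatching.
Variables (V : finType) (g h : rel V).
Hypothesis gh : differ_by_matching g h.

Lemma deg_covered x y : g x y -> ~~ h x y -> deg g x = (deg h x).+1.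
Proof.
have [sub mat] := gh; move=> gxy nh; rewrite /deg (cardsD1 y) inE gxy add1n; congr _.+1.
apply: eq_card => u; rewrite !inE; apply/andP/idP => [[uy gu]|hu].
  by apply/negPn/negP => nhu; case/eqP: uy; apply: (mat x).
by split; [apply: contraNneq nh => <-|apply: sub].
Qed.

Lemma deg_sub x : deg h x <= deg g x <= (deg h x).+1.
Proof.
have [sub _] := gh.
case: (pickP [pred y | g x y && ~~ h x y]) => [y /andP[gxy nh]|no].
  by rewrite (deg_covered gxy nh) leqnSn leqnn.
suff -> : deg g x = deg h x by rewrite leqnn leqnSn.
apply: eq_card => y; rewrite !inE; apply/idP/idP => [gxy|/sub//].
by have := no y; rewrite /= gxy => /negbT/negPn.
Qed.
End DegMatching.

(** * Class 2 graphs: removing one or two matchings to reach the hypothesis *)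

Theorem theorem1p2 (k : nat) (hk : 4 <= k)
  (hyp : forall (W : finType) (h : rel W), simple_graph h -> Delta h = k.-1 ->
     forall f1 f2 : coloring h (chromatic_index h).+1,
       properb f1 -> properb f2 -> kempe_equiv f1 f2)
  (V : finType) (g : rel V) (hg : simple_graph g) (hD : Delta g = k)
  (h2 : class2 g) :
  forall f1 f2 : coloring g k.+2, properb f1 -> properb f2 -> kempe_equiv f1 f2.
Proof.
(* From here on [k] is one less than in the statement: [g] has maximum degree [k.+1] and [k.+3]
   colors, and [hyp] concerns maximum degree [k]. *)
case: k hk hyp hD => // k _ /= hyp hD.
have no_k : ~~ has_coloring g k.+1 by apply: lt_chromatic_index; rewrite h2 hD.
have dg x : deg g x <= k.+1 by rewrite -hD deg_le_Delta.
have [h [hS gh maxh]] := maximal_matching hg.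
have dh x : deg h x <= k.+1.
  by apply: leq_trans (dg x); case/andP: (deg_sub gh x).
(* By maximality one of [x] and [y] is covered, and its degree drops by one. *)
have indep x y : h x y -> (deg h x < k.+1) || (deg h y < k.+1).
  have [sub _] := gh; move/sub/maxh => [][w gw nhw].
    by rewrite -(deg_covered gh gw nhw) dg.
  by rewrite orbC -(deg_covered gh gw nhw) dg.
(* With [k.+3] colors no vertex of [g] reaches the critical degree [k.+2], so independence is
   trivial for [g]. *)
apply: (transfer hg hS gh) => [F1 F2 F1P F2P|x|x y _]; last by rewrite ltnS dg.
  have colh : has_coloring h k.+1.
    by apply: has_coloring_drop => //; apply/existsP; exists F1.
  (* A coloring of [h] with [k] colors, plus one color for the matching, would color [g] with [k.+1]
     colors. So [h] has chromatic index [k.+1]. *)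
  have no_h m : m < k.+1 -> ~~ has_coloring h m.
    rewrite ltnS => mk; apply: contra no_k => hm.
    exact: (has_coloring_lift hg hS gh (has_coloring_le hS mk hm)).
  have DhU : Delta h <= k.+1 by apply/bigmax_leqP.
  have DhL : k <= Delta h.
    have [|x0 dx0] := @Delta_attained _ g; first by rewrite hD.
    apply: leq_trans (deg_le_Delta h x0).
    by case/andP: (deg_sub gh x0) => _; rewrite dx0 hD ltnS.
  case: (eqVneq (Delta h) k) => [Dh|nDh].
    have := hyp _ h hS Dh; rewrite (chromatic_index_eq colh no_h); exact.
  have Dh : Delta h = k.+1 by apply/eqP; rewrite eqn_leq DhU ltn_neqAle eq_sym nDh.
  case/existsP: colh => phi phiP.
  (* Removing the last color class of [phi] lowers each degree by at most one, and the [k] remaining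
     colors bound the degrees above. Thus [h'] has both maximum degree and chromatic index [k], and
     [hyp] settles its colorings with [k.+1] colors. *)
  pose h' : rel V := fun x y => h x y && (ec phi x y != Some ord_max).
  have h'S : simple_graph h'.
    by case: hS => hC hI; split=> [x y|x]; rewrite /h' ?hI // hC ecC.
  have hh' : differ_by_matching h h'.
    split=> [x y /andP[]//|x y y' hxy]; rewrite /h' hxy /= => /negPn/eqP E hxy'.
    by rewrite hxy' /= => /negPn/eqP; apply: (proper_ecP hS _ phiP) E.
  have colh' : has_coloring h' k.
    have [x y hxy|F FP _] := restrict hS h'S hh' phiP; last by apply/existsP; exists F.
    by rewrite /h' hxy /= negbK.
  have Dh' : Delta h' = k.
    apply/eqP; rewrite eqn_leq; apply/andP; split.
      by apply/bigmax_leqP => x _; apply: deg_le_coloring.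
    have [|x0 dx0] := @Delta_attained _ h; first by rewrite Dh.
    apply: leq_trans (deg_le_Delta h' x0).
    by case/andP: (deg_sub hh' x0) => _; rewrite dx0 Dh ltnS.
  apply: (transfer hS h'S hh') => //.
  have := hyp _ h' h'S Dh'; rewrite (chromatic_index_eq colh') //.
  move=> m mk; apply/negP => hm; move: mk; rewrite ltnNge -{1}Dh'.
  by apply/negP/negPn/bigmax_leqP => x _; apply: deg_le_coloring.
by apply: leq_trans (dg x) _.
Qed.
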